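(* Let $\mathcal E,\mathcal A\in\mathbb R^{n\times n}$, $\mathcal B\in\mathbb R^{n\times m}$, $\mathcal C\in\mathbb R^{k\times n}$, $\mathcal F\in\mathbb R^{\ell\times n}$ and $t_1>0$ satisfy the standing hypotheses (H1)–(H4) of the context, and let $\mathcal P$ be the solution for $t\le t_1$ of the generalized differential Riccati equation specified in the context. Let $x_0\in\mathbb R^n$. Then the closed loop system $$\mathcal E\dot x(t)=(\mathcal A-\mathcal B\mathcal B^*\mathcal P(t))x(t),\qquad \mathcal Ex(0)=\mathcal Ex_0,$$ can be written in decoupled form for $x=(x_1,x_2)$ (partitioned conforming with $\mathcal E$), i.e. there are matrix valued functions $\hat{\mathcal A}_1$, $\hat{\mathcal A}_2$ such that the closed loop system is equivalent to $$\dot x_1(t)=\hat{\mathcal A}_1(t)x_1(t),\qquad 0=x_2(t)-\hat{\mathcal A}_2(t)x_1(t),\qquad \mathcal Ex(0)=\mathcal Ex_0.$$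
   Context: $M^*$ denotes the transpose, $M^{-*}:=(M^* )^{-1}$. Definitions: A pair $(\mathcal E,\mathcal A)$ is regular if $s\mathcal E-\mathcal A$ is invertible for some $s\in\mathbb C$. A regular pair is equivalent (by multiplication with invertible matrices from the left and right) to $\left(\begin{bmatrix}I&0\\ 0&N\end{bmatrix},\begin{bmatrix}J&0\\ 0&I\end{bmatrix}\right)$ with $J,N$ in Jordan form and $N$ nilpotent; it is finite dynamics stable if all eigenvalues of $J$ have negative real part. A regular pair is impulse-free if $\operatorname{rank}\begin{bmatrix}\mathcal E&0\\ \mathcal A&\mathcal E\end{bmatrix}=n+\operatorname{rank}\mathcal E$. The generalized algebraic Riccati equation (gARE) is $\mathcal A^*X+X^*\mathcal A-X^*\mathcal B\mathcal B^*X+\mathcal C^*\mathcal C=0$, $\mathcal E^*X=X^*\mathcal E$; a solution $\mathcal P_+$ is stabilizing if $(\mathcal E,\mathcal A-\mathcal B\mathcal B^*\mathcal P_+)$ is regular, impulse-free and finite dynamics stable. Standing hypotheses: (H1) $\mathcal E=\begin{bmatrix}I&0\\ 0&0\end{bmatrix}$ with $I\in\mathbb R^{d\times d}$. (H2) $\operatorname{range}\mathcal F^*\subset\operatorname{range}\mathcal E^*$. (H3) $(\mathcal E,\mathcal A)$ is regular and the gARE has a stabilizing solution $\mathcal P_+$. (H4) With partitions conforming with $\mathcal E$, $\mathcal A=\begin{bmatrix}A_{11}&A_{12}\\ A_{21}&A_{22}\end{bmatrix}$, $\mathcal B=\begin{bmatrix}B_1\\ B_2\end{bmatrix}$, $\mathcal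 C=\begin{bmatrix}C_1&C_2\end{bmatrix}$, $\mathcal P_+=\begin{bmatrix}P_{+;1}&0\\ P_{+;21}&P_{+;2}\end{bmatrix}$ (block lower triangular with $P_{+;1}$ symmetric because $\mathcal E^*\mathcal P_+=\mathcal P_+^*\mathcal E$), $P_2:=P_{+;2}$ and the regular matrix $K_2:=A_{22}^*-P_2^*B_2B_2^*$, the matrix $C_1^*C_1-(A_{21}^*P_2+C_1^*C_2)K_2^{-*}A_{21}-A_{21}^*K_2^{-1}(C_2^*C_1+P_2^*A_{21})-(C_1^*C_2+A_{21}^*P_2)K_2^{-*}B_2B_2^*K_2^{-1}(C_2^*C_1+P_2^*A_{21})$ is positive semidefinite. The generalized differential Riccati equation (gDRE) is $-\mathcal E^*\dot{\mathcal P}=\mathcal A^*\mathcal P+\mathcal P^*\mathcal A-\mathcal P^*\mathcal B\mathcal B^*\mathcal P+\mathcal C^*\mathcal C$, $\mathcal E^*\mathcal P(t_1)=\mathcal F^*\mathcal F$. Under (H1)–(H4) it has a solution for $t\le t_1$; $\mathcal P$ denotes the solution of block lower triangular form $\begin{bmatrix}P_1(t)&0\\ P_{21}(t)&P_2\end{bmatrix}$, $P_1(t)$ symmetric, with constant lower right block $P_2=P_{+;2}$. *)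

(* Defs.v *)
From HB Require Import structures.
From mathcomp Require Import all_boot all_order all_algebra.
From mathcomp Require Import complex.
From mathcomp Require Import all_classical all_reals all_analysis.
Set Implicit Arguments.
Unset Strict Implicit.
Unset Printing Implicit Defensive.
Import Order.TTheory GRing.Theory Num.Theory.
Import numFieldNormedType.Exports.
Local Open Scope classical_set_scope.
Local Open Scope ring_scope.

Definition complex_mx (R : realType) (m n : nat) (M : 'M[R]_(m, n)) :
  'M[R[i]%C]_(m, n) := map_mx (real_complex R) M.

Definition regular_pair (R : realType) (n : nat) (E A : 'M[R]_n) : Prop :=
  exists s : R[i]%C, s *: complex_mx E - complex_mx A \in unitmx.

Definition impulse_free (R : realType) (n : nat) (E A : 'M[R]_n) : Prop :=
  \rank (block_mx E 0 A E) = (n + \rank E)%N.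

Definition jordan_block (K : fieldType) (n : nat) (a : K) : 'M[K]_n :=
  \matrix_(i, j) if j == i then a else ((j : nat) == i.+1)%:R.

Definition jordan_form (K : fieldType) (n : nat) (J : 'M[K]_n) : Prop :=
  exists (k : nat) (p : 'I_k -> nat) (a : 'I_k -> K) (e : (\sum_i p i)%N = n),
    J = castmx (e, e) (\mxdiag_(i < k) jordan_block (p i) (a i)).

Definition nilpotent_mx (K : fieldType) (n : nat) (N : 'M[K]_n) : Prop :=
  exists j : nat, iter j (mulmx N) 1%:M = 0.

(* The pair is (diag(I, N), diag(J, I)) up to the invertible matrices S, T;
   J is determined up to similarity, so its eigenvalues do not depend on the
   choice of S and T. *)
Definition finite_dynamics_stable (R : realType) (n : nat) (E A : 'M[R]_n) :
    Prop :=
  exists (q p : nat) (e : n = (q + p)%N) (S T : 'M[R[i]%C]_n)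
         (J : 'M[R[i]%C]_q) (N : 'M[R[i]%C]_p),
    [/\ S \in unitmx /\ T \in unitmx,
        castmx (e, e) (S *m complex_mx E *m T) = block_mx 1%:M 0 0 N /\
        castmx (e, e) (S *m complex_mx A *m T) = block_mx J 0 0 1%:M,
        jordan_form J /\ jordan_form N,
        nilpotent_mx N
      & forall a : R[i]%C, eigenvalue J a -> complex.Re a < 0].

Definition gARE_rhs (R : realType) (n m k : nat) (A : 'M[R]_n)
    (B : 'M[R]_(n, m)) (C : 'M[R]_(k, n)) (X : 'M[R]_n) : 'M[R]_n :=
  A^T *m X + X^T *m A - X^T *m B *m B^T *m X + C^T *m C.

Definition gARE (R : realType) (n m k : nat) (E A : 'M[R]_n)
    (B : 'M[R]_(n, m)) (C : 'M[R]_(k, n)) (X : 'M[R]_n) : Prop :=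
  gARE_rhs A B C X = 0 /\ E^T *m X = X^T *m E.

Definition stabilizing (R : realType) (n m k : nat) (E A : 'M[R]_n)
    (B : 'M[R]_(n, m)) (C : 'M[R]_(k, n)) (X : 'M[R]_n) : Prop :=
  let Acl := A - B *m B^T *m X in
  [/\ gARE E A B C X, regular_pair E Acl, impulse_free E Acl
    & finite_dynamics_stable E Acl].

Definition psd (R : realType) (n : nat) (M : 'M[R]_n) : Prop :=
  M^T = M /\ forall v : 'cV[R]_n, 0 <= (v^T *m M *m v) 0 0.

Definition K2_mx (R : realType) (d r m : nat) (A : 'M[R]_(d + r))
    (B : 'M[R]_(d + r, m)) (Pp : 'M[R]_(d + r)) : 'M[R]_r :=
  (drsubmx A)^T - (drsubmx Pp)^T *m dsubmx B *m (dsubmx B)^T.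

Definition H4_mx (R : realType) (d r m k : nat) (A : 'M[R]_(d + r))
    (B : 'M[R]_(d + r, m)) (C : 'M[R]_(k, d + r)) (Pp : 'M[R]_(d + r)) :
    'M[R]_d :=
  let A21 : 'M[R]_(r, d) := dlsubmx A in
  let B2 : 'M[R]_(r, m) := dsubmx B in
  let C1 : 'M[R]_(k, d) := lsubmx C in
  let C2 : 'M[R]_(k, r) := rsubmx C in
  let P2 : 'M[R]_r := drsubmx Pp in
  let K2 := K2_mx A B Pp in
  C1^T *m C1
  - (A21^T *m P2 + C1^T *m C2) *m invmx K2^T *m A21
  - A21^T *m invmx K2 *m (C2^T *m C1 + P2^T *m A21)
  - (C1^T *m C2 + A21^T *m P2) *m invmx K2^T *m B2 *m B2^T *m invmx K2
      *m (C2^T *m C1 + P2^T *m A21).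

(* [f] has derivative [l] at [t] along the time set [D]: two-sided at interior
   points of [D], one-sided at the end points of an interval. *)
Definition has_deriv (R : realType) (m n : nat) (D : set R)
    (f : R -> 'M[R]_(m, n)) (t : R) (l : 'M[R]_(m, n)) : Prop :=
  (fun s : R => (s - t)^-1 *: (f s - f t)) @ within D (t^') --> l.

(* E^* (dP/dt) is read as d/dt (E^* P), which asks for no differentiability of
   the part of P that E^* annihilates. *)
Definition gDRE_solution (R : realType) (n m k l : nat) (E A : 'M[R]_n)
    (B : 'M[R]_(n, m)) (C : 'M[R]_(k, n)) (F : 'M[R]_(l, n)) (t1 : R)
    (P : R -> 'M[R]_n) : Prop :=
  (forall t : R, t <= t1 ->
     exists EdP : 'M[R]_n,
       has_deriv [set s | s <= t1] (fun s => E^T *m P s) t EdP /\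
       - EdP = gARE_rhs A B C (P t)) /\
  E^T *m P t1 = F^T *m F.

(* The two solution notions for E x' = Acl(t) x, E x(0) = E x0 on [0, t1]:
   E x' is (E x)' with only E x differentiable, or x itself is
   differentiable. *)
Definition closed_loop_weak (R : realType) (n : nat) (E : 'M[R]_n)
    (Acl : R -> 'M[R]_n) (t1 : R) (x0 : 'cV[R]_n) (x : R -> 'cV[R]_n) : Prop :=
  (forall t : R, 0 <= t <= t1 ->
     exists Edx : 'cV[R]_n,
       has_deriv [set s | 0 <= s <= t1] (fun s => E *m x s) t Edx /\
       Edx = Acl t *m x t) /\
  E *m x 0 = E *m x0.

Definition closed_loop_strong (R : realType) (n : nat) (E : 'M[R]_n)
    (Acl : R -> 'M[R]_n) (t1 : R) (x0 : 'cV[R]_n) (x : R -> 'cV[R]_n) : Prop :=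
  (forall t : R, 0 <= t <= t1 ->
     exists dx : 'cV[R]_n,
       has_deriv [set s | 0 <= s <= t1] x t dx /\
       E *m dx = Acl t *m x t) /\
  E *m x 0 = E *m x0.

Definition decoupled (R : realType) (d r : nat) (E : 'M[R]_(d + r))
    (A1 : R -> 'M[R]_d) (A2 : R -> 'M[R]_(r, d)) (t1 : R)
    (x0 : 'cV[R]_(d + r)) (x : R -> 'cV[R]_(d + r)) : Prop :=
  (forall t : R, 0 <= t <= t1 ->
     (exists dx1 : 'cV[R]_d,
        has_deriv [set s | 0 <= s <= t1] (fun s => usubmx (x s)) t dx1 /\
        dx1 = A1 t *m usubmx (x t)) /\
     0 = dsubmx (x t) - A2 t *m usubmx (x t)) /\
  E *m x 0 = E *m x0.

(* Main.v *)
Require Import Defs.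
From HB Require Import structures.
From mathcomp Require Import all_boot all_order all_algebra.
From mathcomp Require Import complex.
From mathcomp Require Import all_classical all_reals all_analysis.
Import Order.TTheory GRing.Theory Num.Theory.
Import numFieldNormedType.Exports.
Local Open Scope ring_scope.

(** For E = diag(I, 0) the closed loop with matrix M(t) = A - B B^T P(t) is a
    semi-explicit system: the lower block row 0 = M21 x1 + M22 x2 is purely
    algebraic.  Everything rests on M22 being invertible; then x2 equals
    - M22^-1 M21 x1, and substitution into the upper row leaves an ordinary
    differential equation for x1 ([semi_explicit_eqP]).

    Since P(t) is block lower triangular with lower right block P_(+;2), the
    block M22 does not depend on t: it is K2^T
    ([drsubmx_closed_loop]), and it is also the lower right block of the closed
    loop matrix of the stabilizing solution P_+.  The pair formed by E and the
    latter matrix is impulse-free, which for this E says precisely that the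
    lower right block is invertible ([impulse_free_drsubmx_unit]).

    When only E x is required to be differentiable, that is the whole story.
    When x itself must be differentiable, one has to see that the x2 recovered
    from x1 is differentiable, hence that P21(t), on which M21(t) depends, is
    differentiable, although the Riccati equation only speaks of the derivative
    of E^T P, that is, of P1.  The upper right block of E^T P vanishes
    identically, so the same block of the equation is algebraic; it reads
    P21^T K2^T = (an affine function of P1) ([ursubmx_gARE_rhs]).  Hence P21 is
    an affine function of P1 ([dlsubmx_of_gARE_rhs0]) and inherits its
    differentiability. *)

Set Implicit Arguments.
Unset Strict Implicit.
Unset Printing Implicit Defensive.
Local Open Scope classical_set_scope.

(** * Limits of matrix-valued functions *)

(** In finite dimension every linear map is continuous: expanded on the
    elementary matrices, g M is a finite sum of entries of M times constants. *)
Lemma cvg_linear_mx (R : realType) (T : Type) (G : set_system T) (m n p q : nat)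
    (g : {linear 'M[R]_(m, n) -> 'M[R]_(p, q)})
    (f : T -> 'M[R]_(m, n)) (a : 'M[R]_(m, n)) :
  Filter G -> f @ G --> a -> (fun s => g (f s)) @ G --> g a.
Proof.
move=> GF fa.
have gE (M : 'M[R]_(m, n)) :
    g M = \sum_i \sum_j M i j *: g (delta_mx i j).
  rewrite {1}(matrix_sum_delta M) linear_sum; apply: eq_bigr => i _.
  by rewrite linear_sum; apply: eq_bigr => j _; rewrite linearZ.
rewrite gE; under eq_fun do rewrite gE.
apply: cvg_big => // [|i _]; first exact: add_continuous.
apply: cvg_big => // [|j _]; first exact: add_continuous.
apply: cvgZl.
exact: cvg_comp _ _ fa (@coord_continuous _ _ _ i j a).
Qed.

Lemma cvg_mulmx (R : realType) (T : Type) (G : set_system T) (m n p : nat)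
    (f : T -> 'M[R]_(m, n)) (g : T -> 'M[R]_(n, p))
    (a : 'M[R]_(m, n)) (b : 'M[R]_(n, p)) :
  Filter G -> f @ G --> a -> g @ G --> b ->
  (fun s => f s *m g s) @ G --> a *m b.
Proof.
move=> GF fa gb.
have mE (M : 'M[R]_(m, n)) (N : 'M[R]_(n, p)) :
    M *m N = \sum_i \sum_j M i j *: (delta_mx i j *m N).
  rewrite {1}(matrix_sum_delta M) mulmx_suml; apply: eq_bigr => i _.
  by rewrite mulmx_suml; apply: eq_bigr => j _; rewrite scalemxAl.
rewrite mE; under eq_fun do rewrite mE.
apply: cvg_big => // [|i _]; first exact: add_continuous.
apply: cvg_big => // [|j _]; first exact: add_continuous.
apply: cvgZ; first exact: cvg_comp _ _ fa (@coord_continuous _ _ _ i j a).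
exact: (@cvg_linear_mx _ _ _ _ _ _ _ (mulmx (delta_mx i j))).
Qed.

(** * Calculus of derivatives along a time set *)

Section Derivatives.
Variables (R : realType) (D : set R) (t : R).

Local Instance within_dnbhs_filter : Filter (within D (t^')).
Proof. exact: within_filter. Qed.

Lemma has_deriv_eq (m n : nat) (f g : R -> 'M[R]_(m, n)) l :
  D t -> (forall s, D s -> f s = g s) ->
  has_deriv D f t l -> has_deriv D g t l.
Proof.
move=> Dt fg; apply: cvg_trans; apply: fmap_within_eq => s /set_mem Ds.
by rewrite !fg.
Qed.

Lemma has_deriv_linear (m n p q : nat)
    (g : {linear 'M[R]_(m, n) -> 'M[R]_(p, q)}) (f : R -> 'M[R]_(m, n)) l :
  has_deriv D f t l -> has_deriv D (fun s => g (f s)) t (g l).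
Proof.
move=> fl; rewrite /has_deriv; under eq_fun do rewrite -linearB -linearZ.
exact: cvg_linear_mx.
Qed.

Lemma has_derivD (m n : nat) (f g : R -> 'M[R]_(m, n)) l k :
  has_deriv D f t l -> has_deriv D g t k ->
  has_deriv D (fun s => f s + g s) t (l + k).
Proof.
move=> fl gk; rewrite /has_deriv.
under eq_fun do rewrite opprD addrACA scalerDr.
exact: cvgD.
Qed.

Lemma has_deriv_cst (m n : nat) (c : 'M[R]_(m, n)) :
  has_deriv D (fun=> c) t 0.
Proof.
rewrite /has_deriv; under eq_fun do rewrite subrr scaler0.
exact: cvg_cst.
Qed.

(** Differentiability implies continuity, which the product rule needs for one
    of its factors: f s is f t plus (s - t) times the difference quotient. *)
Lemma has_deriv_cvg (m n : nat) (f : R -> 'M[R]_(m, n)) l :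
  has_deriv D f t l -> f @ within D (t^') --> f t.
Proof.
move=> fl.
have st : (fun s : R => s - t) @ within D (t^') --> (0 : R).
  rewrite -(subrr t); apply: cvgB; last exact: cvg_cst.
  by move=> U; apply: filterS.
have incr0 : (fun s => (s - t) *: ((s - t)^-1 *: (f s - f t)) + f t)
    @ within D (t^') --> f t.
  rewrite -[X in _ --> X]add0r -(scale0r l).
  by apply: cvgD; [exact: cvgZ|exact: cvg_cst].
apply: (cvg_trans _ incr0); apply: near_eq_cvg.
apply: cvg_within; near=> s => /=.
have nst : s - t != 0.
  by rewrite subr_eq0; near: s; exact: nbhs_dnbhs_neq.
by rewrite scalerA mulfV // scale1r subrK.
Unshelve. all: by end_near. Qed.

Lemma has_derivM (m n p : nat) (f : R -> 'M[R]_(m, n)) (g : R -> 'M[R]_(n, p))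
    l k :
  has_deriv D f t l -> has_deriv D g t k ->
  has_deriv D (fun s => f s *m g s) t (l *m g t + f t *m k).
Proof.
move=> fl gk; rewrite /has_deriv.
have -> : (fun s => (s - t)^-1 *: (f s *m g s - f t *m g t)) =
    (fun s => ((s - t)^-1 *: (f s - f t)) *m g s
              + f t *m ((s - t)^-1 *: (g s - g t))).
  apply/funext => s; rewrite -scalemxAl -scalemxAr -scalerDr.
  by rewrite mulmxBl mulmxBr addrA subrK.
apply: cvgD; apply: cvg_mulmx => //; first exact: has_deriv_cvg gk.
exact: cvg_cst.
Qed.

(** The derivative is unique only where t is a limit point of D, which is what
    the properness of the filter expresses. *)
Lemma has_deriv_eq0 (m n : nat) (f : R -> 'M[R]_(m, n)) l :
  ProperFilter (within D (t^')) -> D t -> (forall s, D s -> f s = 0) ->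
  has_deriv D f t l -> l = 0.
Proof.
move=> PF Dt f0 fl; have zl := has_deriv_eq Dt f0 fl.
exact: norm_cvg_unique zl (has_deriv_cst _).
Qed.

End Derivatives.

Arguments has_deriv_linear {R D t m n p q} g {f l} _.
Arguments has_deriv_cst {R} D t {m n} c.

Lemma has_deriv_subset (R : realType) (D1 D2 : set R) (t : R) (m n : nat)
    (f : R -> 'M[R]_(m, n)) l :
  D1 `<=` D2 -> has_deriv D2 f t l -> has_deriv D1 f t l.
Proof.
by move=> D12; apply: cvg_trans; apply: cvg_fmap2; apply: within_subset.
Qed.

(** A nondegenerate interval has no isolated point: a point below b is
    approached from the right, and b itself from the left. *)
Lemma proper_within_itv (R : realType) (a b t : R) :
  a < b -> a <= t <= b -> ProperFilter (within [set s | a <= s <= b] (t^')).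
Proof.
move=> ab /andP[at_ tb]; apply: Build_ProperFilter_ex => U.
move=> /nbhs_ballP[e /= e0 eU].
have [tb'|] := ltP t b.
  pose s := Num.min b (t + e / 2).
  have ts : t < s by rewrite lt_min tb' ltrDl divr_gt0.
  have se : s <= t + e / 2 by rewrite ge_min lexx orbT.
  exists s; apply: eU => /=.
  - rewrite /ball /= distrC ger0_norm ?subr_ge0 ?(ltW ts) //.
    rewrite ltrBlDl (le_lt_trans se) // ltrD2l.
    by rewrite ltr_pdivrMr // mulr_natr mulr2n ltrDl.
  - by rewrite gt_eqF.
  - by rewrite (le_trans at_ (ltW ts)) /= ge_min lexx.
move=> bt; have at' : a < t by exact: lt_le_trans bt.
pose s := Num.max a (t - e / 2).
have ts : s < t by rewrite gt_max at' /= ltrBlDr ltrDl divr_gt0.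
have se : t - e / 2 <= s by rewrite le_max lexx orbT.
exists s; apply: eU => /=.
- rewrite /ball /= ger0_norm ?subr_ge0 ?(ltW ts) //.
  rewrite ltrBlDl -ltrBlDr (lt_le_trans _ se) // ltrD2l ltrN2.
  by rewrite ltr_pdivrMr // mulr_natr mulr2n ltrDl.
- by rewrite lt_eqF.
- by rewrite (le_trans (ltW ts) tb) andbT le_max lexx.
Qed.

(** * Impulse-freeness *)

(** The left kernel of [E 0; M E] contains the free vectors (0, w, 0, 0) as well
    as (- v M21, 0, 0, v) for every v with v M22 = 0, so its dimension is at
    least r + dim ker M22.  The rank condition makes it exactly r, and M22 has
    a trivial kernel. *)
Lemma impulse_free_drsubmx_unit (R : realType) (d r : nat) (M : 'M[R]_(d + r)) :
  impulse_free (block_mx 1%:M 0 0 0) M -> drsubmx M \in unitmx.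
Proof.
rewrite /impulse_free rank_diag_block_mx mxrank1 mxrank0 addn0.
set E : 'M[R]_(d + r) := block_mx 1%:M 0 0 0.
set N := block_mx E 0 M E => rkN.
set K := kermx (drsubmx M).
(* The rows of Y span the kernel vectors; Z selects the coordinates w and v,
   which shows that they are independent. *)
pose Y : 'M[R]_(r + r, (d + r) + (d + r)) :=
  block_mx (row_mx 0 1%:M) 0 (row_mx (- (K *m dlsubmx M)) 0) (row_mx 0 K).
have YN0 : Y *m N = 0.
  rewrite /Y /N mulmx_block !mulmx0 !mul0mx -{2}(submxK M) /E !mul_row_block.
  rewrite !(mulmx0, mul0mx, mulmx1, addr0, add0r) mulmx_ker.
  by rewrite add_row_mx addr0 addNr row_mx0 block_mx0.
have rkY : (r + \rank K <= \rank Y)%N.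
  pose Z : 'M[R]_((d + r) + (d + r), r + r) :=
    block_mx (col_mx 0 1%:M) 0 0 (col_mx 0 1%:M).
  have YZ : Y *m Z = block_mx 1%:M 0 0 K.
    rewrite /Y /Z mulmx_block !mul_row_col.
    by rewrite !(mulmx0, mul0mx, mulmx1, addr0, add0r).
  by rewrite -{1}(mxrank1 R r) -rank_diag_block_mx -YZ mxrankM_maxl.
have := mulmx0_rank_max YN0; rewrite rkN => le_n.
suff : (\rank K <= 0)%N.
  by rewrite leqn0 mxrank_eq0 -row_free_unit -kermx_eq0.
rewrite -(leq_add2l ((d + r) + (d + r))) addn0.
apply: leq_trans le_n; apply: leq_trans (leq_add rkY (leqnn _)).
by rewrite [leqRHS]addnC !addnA.
Qed.

(** * Blocks of the closed loop matrix and of the Riccati operator *)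

Section ClosedLoop.
Variables (R : realType) (d r m k : nat).
Variables (A : 'M[R]_(d + r)) (B : 'M[R]_(d + r, m)) (C : 'M[R]_(k, d + r)).
Implicit Types X : 'M[R]_(d + r).

Let A12 : 'M[R]_(d, r) := ursubmx A.
Let A21 : 'M[R]_(r, d) := dlsubmx A.
Let B1 : 'M[R]_(d, m) := usubmx B.
Let B2 : 'M[R]_(r, m) := dsubmx B.
Let C1 : 'M[R]_(k, d) := lsubmx C.
Let C2 : 'M[R]_(k, r) := rsubmx C.

Lemma trmx_K2_mx X :
  (K2_mx A B X)^T = drsubmx A - B2 *m B2^T *m drsubmx X.
Proof. by rewrite /K2_mx linearB /= !trmx_mul !trmxK mulmxA. Qed.

Lemma drsubmx_closed_loop X :
  ursubmx X = 0 -> drsubmx (A - B *m B^T *m X) = (K2_mx A B X)^T.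
Proof.
move=> X12; rewrite trmx_K2_mx.
rewrite -[in LHS](submxK X) X12 -[in LHS](vsubmxK B) tr_col_mx.
rewrite mul_col_row mulmx_block -[in LHS](submxK A) opp_block_mx add_block_mx.
by rewrite block_mxKdr mulmx0 add0r.
Qed.

Lemma dlsubmx_closed_loop X :
  dlsubmx (A - B *m B^T *m X) =
  A21 - B2 *m B1^T *m ulsubmx X - B2 *m B2^T *m dlsubmx X.
Proof.
rewrite -[in LHS](submxK X) -[in LHS](vsubmxK B) tr_col_mx.
rewrite mul_col_row mulmx_block -[in LHS](submxK A) opp_block_mx add_block_mx.
by rewrite block_mxKdl opprD addrA.
Qed.

(** For a triangular X the right factor B^T X of the quadratic term has the
    second block column B2^T X22, so this block is affine in X11 and X21 once X22
    is fixed.  The coefficient of X21^T is A22 - B2 B2^T X22, which is K2^T. *)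
Lemma ursubmx_gARE_rhs X :
  ursubmx X = 0 -> (ulsubmx X)^T = ulsubmx X ->
  ursubmx (gARE_rhs A B C X) =
  A21^T *m drsubmx X + C1^T *m C2
  + ulsubmx X *m (A12 - B1 *m B2^T *m drsubmx X)
  + (dlsubmx X)^T *m (K2_mx A B X)^T.
Proof.
move=> X12 X11; rewrite trmx_K2_mx.
rewrite /gARE_rhs -[in LHS](submxK X) X12 -[in LHS](vsubmxK B).
rewrite -[in LHS](hsubmxK C) -[in LHS](submxK A).
rewrite !tr_block_mx tr_col_mx tr_row_mx X11 !trmx0.
rewrite !mul_col_row !mulmx_block mul_block_col mul_col_row mulmx_block.
rewrite opp_block_mx !add_block_mx block_mxKur.
rewrite !(mulmx0, mul0mx, addr0, add0r) !mulmxBr !mulmxDl !mulmxA.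
by rewrite opprD [LHS](AC (1*2*2*1) ((1*6)*(2*4)*(3*5))).
Qed.

Lemma dlsubmx_of_gARE_rhs0 X :
  K2_mx A B X \in unitmx -> ursubmx X = 0 -> (ulsubmx X)^T = ulsubmx X ->
  ursubmx (gARE_rhs A B C X) = 0 ->
  dlsubmx X = ((A21^T *m drsubmx X + C1^T *m C2
     + ulsubmx X *m (A12 - B1 *m B2^T *m drsubmx X))
       *m - invmx (K2_mx A B X)^T)^T.
Proof.
move=> K2u X12 X11; rewrite ursubmx_gARE_rhs // => /eqP.
rewrite addr_eq0 => /eqP ->; rewrite mulNmx mulmxN opprK.
by rewrite mulmxK ?unitmx_tr // trmxK.
Qed.

End ClosedLoop.

(** * Decoupling of semi-explicit systems *)

Section SemiExplicit.
Variables (R : realType) (d r : nat).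
Implicit Types M : 'M[R]_(d + r).

Definition algebraic_part M : 'M[R]_(r, d) :=
  - (invmx (drsubmx M) *m dlsubmx M).

(** The Schur complement of the lower right block of M. *)
Definition reduced_mx M : 'M[R]_d :=
  ulsubmx M + ursubmx M *m algebraic_part M.

Lemma semi_explicit_eqP M (x : 'cV[R]_(d + r)) (y : 'cV[R]_d) :
  drsubmx M \in unitmx ->
  col_mx y 0 = M *m x <->
  y = reduced_mx M *m usubmx x /\
  0 = dsubmx x - algebraic_part M *m usubmx x.
Proof.
move=> Mu; rewrite -[in M *m x](submxK M) -[in _ *m x](vsubmxK x) mul_block_col.
have redE : dsubmx x = algebraic_part M *m usubmx x ->
    reduced_mx M *m usubmx x =
    ulsubmx M *m usubmx x + ursubmx M *m dsubmx x.
  by move=> ->; rewrite /reduced_mx mulmxDl mulmxA.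
split=> [/eq_col_mx[-> x2]|[-> /esym/subr0_eq x2]].
  have x2E : dsubmx x = algebraic_part M *m usubmx x.
    rewrite /algebraic_part mulNmx -mulmxA -mulmxN; apply: (canRL (mulKmx Mu)).
    by apply/eqP; rewrite -addr_eq0 addrC -x2.
  by rewrite redE // x2E subrr.
congr col_mx; first exact: redE.
by rewrite x2 /algebraic_part mulNmx mulmxN -mulmxA mulKVmx // subrr.
Qed.

Local Notation E := (block_mx 1%:M 0 0 0 : 'M[R]_(d + r)).

Lemma mul_semi_explicit (x : 'cV[R]_(d + r)) : E *m x = col_mx (usubmx x) 0.
Proof.
by rewrite -[in LHS](vsubmxK x) mul_block_col mul1mx !mul0mx !addr0.
Qed.

Variables (Acl : R -> 'M[R]_(d + r)) (t1 : R).
Hypothesis t1_gt0 : 0 < t1.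
Hypothesis Acl22_unit :
  forall t, 0 <= t <= t1 -> drsubmx (Acl t) \in unitmx.
Let D : set R := [set s | 0 <= s <= t1].
Let A1 t := reduced_mx (Acl t).
Let A2 t := algebraic_part (Acl t).

Lemma closed_loop_weak_decoupled x0 x :
  closed_loop_weak E Acl t1 x0 x <-> decoupled E A1 A2 t1 x0 x.
Proof.
split=> -[loop init]; split=> // t tD.
  have [dEx [dExP dExE]] := loop t tD.
  have PF := proper_within_itv t1_gt0 tD.
  have dEx2 : dsubmx dEx = 0.
    apply: (has_deriv_eq0 PF tD _ (has_deriv_linear dsubmx dExP)) => s _ /=.
    by rewrite mul_semi_explicit col_mxKd.
  have : col_mx (usubmx dEx) 0 = Acl t *m x t by rewrite -dEx2 vsubmxK.
  move=> /(semi_explicit_eqP _ _ (Acl22_unit tD))[y1 x2].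
  split=> //; exists (usubmx dEx); split=> //.
  apply: (has_deriv_eq tD _ (has_deriv_linear usubmx dExP)) => s _ /=.
  by rewrite mul_semi_explicit col_mxKu.
have [[dx1 [dx1P dx1E]] x2] := loop t tD.
exists (col_mx dx1 0); split; last first.
  exact/semi_explicit_eqP/(conj dx1E x2)/Acl22_unit.
have -> : col_mx dx1 0 = (col_mx 1%:M 0 : 'M[R]_(d + r, d)) *m dx1.
  by rewrite mul_col_mx mul1mx mul0mx.
apply: (has_deriv_eq tD _
  (has_deriv_linear (mulmx (col_mx 1%:M 0)) dx1P)) => s _ /=.
by rewrite mul_semi_explicit mul_col_mx mul1mx mul0mx.
Qed.

(** A solution of the decoupled system determines x2 as A2 x1, and the product
    rule differentiates it as soon as A2 is differentiable. *)
Lemma closed_loop_strong_decoupled x0 x :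
  (forall t, 0 <= t <= t1 -> exists l, has_deriv D A2 t l) ->
  closed_loop_strong E Acl t1 x0 x <-> decoupled E A1 A2 t1 x0 x.
Proof.
move=> A2_deriv; split=> [[loop init]|[loop init]].
  apply/closed_loop_weak_decoupled; split=> // t tD.
  have [dx [dxP dxE]] := loop t tD.
  exists (E *m dx); split=> //.
  exact: (has_deriv_linear (mulmx E) dxP).
split=> // t tD.
have [[dx1 [dx1P dx1E]] x2] := loop t tD; have [l A2l] := A2_deriv t tD.
have dx2P := has_derivM A2l dx1P; set dx2 := (X in has_deriv _ _ _ X) in dx2P.
exists (col_mx dx1 dx2); split; last first.
  rewrite mul_semi_explicit col_mxKu.
  exact/semi_explicit_eqP/(conj dx1E x2)/Acl22_unit.
have colE (u : 'cV[R]_d) (v : 'cV[R]_r) :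
    col_mx u v = col_mx 1%:M 0 *m u + col_mx 0 1%:M *m v.
  by rewrite !mul_col_mx !mul1mx !mul0mx add_col_mx addr0 add0r.
rewrite colE.
apply: has_deriv_eq tD _ (has_derivD
  (has_deriv_linear (mulmx (col_mx 1%:M 0)) dx1P)
  (has_deriv_linear (mulmx (col_mx 0 1%:M)) dx2P)) => s sD /=.
have [_ /esym/subr0_eq x2s] := loop s sD.
by rewrite -x2s -colE vsubmxK.
Qed.

End SemiExplicit.

Local Close Scope classical_set_scope.
Unset Implicit Arguments.

Theorem corollary5p8 (R : realType) (d r m k l : nat)
    (E A : 'M[R]_(d + r)) (B : 'M[R]_(d + r, m)) (C : 'M[R]_(k, d + r))
    (F : 'M[R]_(l, d + r)) (t1 : R) (Pp : 'M[R]_(d + r))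
    (P : R -> 'M[R]_(d + r))
    (t1_gt0 : 0 < t1)
    (H1 : E = block_mx 1%:M 0 0 0)
    (* row spaces, that is, the ranges of F^T and E^T *)
    (H2 : (F <= E)%MS)
    (H3 : regular_pair E A /\ stabilizing E A B C Pp)
    (H4 : psd (H4_mx A B C Pp))
    (P_sol : gDRE_solution E A B C F t1 P)
    (P_form : forall t : R, t <= t1 ->
       [/\ ursubmx (P t) = 0,
           (ulsubmx (P t))^T = ulsubmx (P t)
         & drsubmx (P t) = drsubmx Pp]) :
  exists (A1 : R -> 'M[R]_d) (A2 : R -> 'M[R]_(r, d)),
    forall (x0 : 'cV[R]_(d + r)) (x : R -> 'cV[R]_(d + r)),
      let Acl := fun t : R => A - B *m B^T *m P t in
      (closed_loop_weak E Acl t1 x0 x <-> decoupled E A1 A2 t1 x0 x) /\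
      (closed_loop_strong E Acl t1 x0 x <-> decoupled E A1 A2 t1 x0 x).
Proof.
subst E.
set E : 'M[R]_(d + r) := block_mx 1%:M 0 0 0 in H2 H3 P_sol *.
have ET : E^T = E by rewrite /E tr_block_mx trmx1 !trmx0.
case: H3 => _ [[_ symPp] _ imp _].
have Pp12 : ursubmx Pp = 0.
  move/(congr1 ursubmx): symPp; rewrite ET /E -(submxK Pp) tr_block_mx.
  rewrite !mulmx_block !block_mxKur.
  by rewrite !(mul1mx, mul0mx, mulmx0, addr0).
have K2u : K2_mx A B Pp \in unitmx.
  rewrite -unitmx_tr -(drsubmx_closed_loop A B Pp12).
  exact: impulse_free_drsubmx_unit.
have K2E t : t <= t1 -> K2_mx A B (P t) = K2_mx A B Pp.
  by move=> /P_form[_ _ P22]; rewrite /K2_mx P22.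
pose Acl t := A - B *m B^T *m P t.
have Acl22 t : 0 <= t <= t1 -> drsubmx (Acl t) = (K2_mx A B Pp)^T.
  move=> /andP[_ tt1]; rewrite -(K2E t tt1); apply: drsubmx_closed_loop.
  by case: (P_form t tt1).
have Acl22u t : 0 <= t <= t1 -> drsubmx (Acl t) \in unitmx.
  by move=> /Acl22 ->; rewrite unitmx_tr.
pose D : set R := [set s | 0 <= s <= t1]%classic.
have P1_deriv t : D t -> exists q, has_deriv D (fun s => ulsubmx (P s)) t q /\
    ursubmx (gARE_rhs A B C (P t)) = 0.
  move=> tD; have /andP[_ tt1] : 0 <= t <= t1 := tD.
  have [EdP [EdPP EdPE]] := P_sol.1 t tt1.
  have {}EdPP : has_deriv D (fun s => E^T *m P s) t EdP.
    by apply: has_deriv_subset EdPP => s /andP[].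
  have EPE s : D s -> E^T *m P s = block_mx (ulsubmx (P s)) 0 0 0.
    move=> /andP[_ /P_form[P12 _ _]]; rewrite ET /E -[in LHS](submxK (P s)) P12.
    by rewrite mulmx_block !(mul1mx, mul0mx, addr0).
  exists (ulsubmx EdP); split.
    apply: (has_deriv_eq tD _
      (has_deriv_linear lsubmx (has_deriv_linear usubmx EdPP))) => s sD /=.
    by rewrite EPE //; exact: block_mxKul.
  (* This block of E^T P is constantly zero, so it carries no derivative. *)
  have EdP12 : ursubmx EdP = 0.
    have PF := proper_within_itv t1_gt0 tD.
    apply: (has_deriv_eq0 PF tD _
      (has_deriv_linear rsubmx (has_deriv_linear usubmx EdPP))) => s sD /=.
    by rewrite EPE //; exact: block_mxKur.
  by rewrite -EdPE /ursubmx !linearN /= -/(ursubmx EdP) EdP12 oppr0.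
have P21E t : D t -> dlsubmx (P t) = (((dlsubmx A)^T *m drsubmx Pp
    + (lsubmx C)^T *m rsubmx C
    + ulsubmx (P t) *m (ursubmx A - usubmx B *m (dsubmx B)^T *m drsubmx Pp))
      *m - invmx (K2_mx A B Pp)^T)^T.
  move=> tD; have [q [_ rhs12]] := P1_deriv t tD.
  have /andP[_ tt1] : 0 <= t <= t1 := tD; have [P12 P11 P22] := P_form t tt1.
  by rewrite -P22 -(K2E t tt1); apply: dlsubmx_of_gARE_rhs0; rewrite // K2E.
have A2_deriv t : D t ->
    exists q, has_deriv D (fun s => algebraic_part (Acl s)) t q.
  move=> tD; have [q [P1q _]] := P1_deriv t tD.
  have P21q := has_deriv_eq tD (fun s sD => esym (P21E s sD))
    (has_deriv_linear trmx (has_deriv_linear (mulmxr (- invmx (K2_mx A B Pp)^T))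
      (has_derivD (has_deriv_cst D t ((dlsubmx A)^T *m drsubmx Pp
                                       + (lsubmx C)^T *m rsubmx C))
        (has_deriv_linear (mulmxr (ursubmx A
           - usubmx B *m (dsubmx B)^T *m drsubmx Pp)) P1q)))).
  eexists; apply: (has_deriv_eq tD _
    (has_deriv_linear (mulmx (- invmx (K2_mx A B Pp)^T))
      (has_derivD (has_derivD (has_deriv_cst D t (dlsubmx A))
        (has_deriv_linear (mulmx (- (dsubmx B *m (usubmx B)^T))) P1q))
        (has_deriv_linear (mulmx (- (dsubmx B *m (dsubmx B)^T))) P21q))))
    => s sD /=.
  by rewrite /algebraic_part Acl22 // dlsubmx_closed_loop !mulNmx.
exists (fun t => reduced_mx (Acl t)), (fun t => algebraic_part (Acl t)).
move=> x0 x; split; first exact: closed_loop_weak_decoupled.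
exact: closed_loop_strong_decoupled.
Qed.
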